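(* Let $n\ge 1$. Let $Flip(2n)$ be the group generated by the in and out flip shuffles acting on a deck of $2n$ cards (where the state of the deck records both the order of the cards and the face-up/face-down orientation of each card), and let $Faro(4n)$ be the group of permutations of a deck of $4n$ cards generated by the in and out faro shuffles. Then $Flip(2n)$ and $Faro(4n)$ are isomorphic (as groups acting on decks); in particular $|Flip(2n)|=|Faro(4n)|$.
   Context: Positions in a deck of $m$ cards are labeled $0,1,\ldots,m-1$ from top to bottom. Faro shuffles on a deck of $2N$ cards: the out faro shuffle sends the card at position $i$ ($0\le i\le N-1$) to position $2i$ and the card at position $N+i$ to position $2i+1$; the in faro shuffle sends the card at position $i$ ($0\le i\le N-1$) to position $2i+1$ and the card at position $N+i$ to position $2i$. $Faro(2N)$ is the subgroup of the symmetric group on the $2N$ positions generated by these two permutations. Flip shuffles on a deck of $2n$ cards, each card being face-up or face-down: cut the deck into the top half (positions $0,\ldots,n-1$) and the bottom half (positions $n,\ldots,2n-1$), turn the bottom half over as a packet (this reverses its order and changes the face-up/face-down status of each of its cards), and perfectly interlace. For the out flip shuffle, for $0\le j\le n-1$ the new position $2j$ receives the card previously at position $j$ (orientation unchanged) and the new position $2j+1$ receives the card previously at position $2n-1-j$, turned over. For the in flip shuffle, the new position $2j$ receives the card previously at position $2n-1-j$, turned over, and the new position $2j+1$ receives the card previously at position $j$ (orientation unchanged). $Flip(2n)$ is the group generated by these two operations on the set of (ordering, orientation) configurations of the deck, i.e. a subgroup of the group of signed permutations of $2n$ objects. *)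

(* Defs.v *)
From mathcomp Require Import all_boot all_fingroup.
From mathcomp Require Import zify.

Set Implicit Arguments.
Unset Strict Implicit.
Unset Printing Implicit Defensive.

(* Faro shuffles of [2 * N] cards, as permutations of the positions: position
   [i] is sent to the new position of the card that was at [i]. *)

Definition out_faro_nat (N i : nat) : nat :=
  if i < N then (2 * i)%N else (2 * (i - N) + 1)%N.

Definition in_faro_nat (N i : nat) : nat :=
  if i < N then (2 * i + 1)%N else (2 * (i - N))%N.

Lemma out_faro_subproof N (i : 'I_(2 * N)) : out_faro_nat N i < 2 * N.
Proof. by have := ltn_ord i; rewrite /out_faro_nat; case: ifP; lia. Qed.

Lemma in_faro_subproof N (i : 'I_(2 * N)) : in_faro_nat N i < 2 * N.
Proof. by have := ltn_ord i; rewrite /in_faro_nat; case: ifP; lia. Qed.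

Definition out_faro_pos N (i : 'I_(2 * N)) : 'I_(2 * N) :=
  Ordinal (out_faro_subproof i).

Definition in_faro_pos N (i : 'I_(2 * N)) : 'I_(2 * N) :=
  Ordinal (in_faro_subproof i).

Lemma out_faro_pos_inj N : injective (@out_faro_pos N).
Proof.
move=> i j /(congr1 val) /=; rewrite /out_faro_nat => e; apply: val_inj => /=.
by move: e; case: (ltnP i N); case: (ltnP j N); lia.
Qed.

Lemma in_faro_pos_inj N : injective (@in_faro_pos N).
Proof.
move=> i j /(congr1 val) /=; rewrite /in_faro_nat => e; apply: val_inj => /=.
by move: e; case: (ltnP i N); case: (ltnP j N); lia.
Qed.

Definition out_faro N : 'S_(2 * N) := perm (@out_faro_pos_inj N).
Definition in_faro N : 'S_(2 * N) := perm (@in_faro_pos_inj N).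

(* [Faro N] is the faro group on [2 * N] cards (not on [N] cards). *)
Definition Faro N : {group 'S_(2 * N)} := <<[set out_faro N; in_faro N]>>%G.

(* A configuration of a deck of [2 * n] two-sided cards: [c.1 p] is the card at
   position [p], and [c.2 p] is [true] iff that card is face-up. *)
Definition config n := ({perm 'I_(2 * n)} * {ffun 'I_(2 * n) -> bool})%type.

(* For the flip shuffles, a new position [p] is sent to the old position of the
   card that it receives. *)

Definition out_flip_nat (n p : nat) : nat :=
  if odd p then (2 * n - 1 - p./2)%N else p./2.

Definition in_flip_nat (n p : nat) : nat :=
  if odd p then p./2 else (2 * n - 1 - p./2)%N.

Lemma out_flip_subproof n (p : 'I_(2 * n)) : out_flip_nat n p < 2 * n.
Proof. by have := ltn_ord p; rewrite /out_flip_nat; case: ifP; lia. Qed.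

Lemma in_flip_subproof n (p : 'I_(2 * n)) : in_flip_nat n p < 2 * n.
Proof. by have := ltn_ord p; rewrite /in_flip_nat; case: ifP; lia. Qed.

Definition out_flip_src n (p : 'I_(2 * n)) : 'I_(2 * n) :=
  Ordinal (out_flip_subproof p).

Definition in_flip_src n (p : 'I_(2 * n)) : 'I_(2 * n) :=
  Ordinal (in_flip_subproof p).

Lemma out_flip_src_inj n : injective (@out_flip_src n).
Proof.
move=> p q /(congr1 val) /=; rewrite /out_flip_nat => e; apply: val_inj => /=.
by have := ltn_ord p; have := ltn_ord q; move: e; do 2![case: ifP]; lia.
Qed.

Lemma in_flip_src_inj n : injective (@in_flip_src n).
Proof.
move=> p q /(congr1 val) /=; rewrite /in_flip_nat => e; apply: val_inj => /=.
by have := ltn_ord p; have := ltn_ord q; move: e; do 2![case: ifP]; lia.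
Qed.

(* Position [p] receives the card previously at [src p], turned over iff
   [turn p]; recall that [(s * t) p = t (s p)] for permutations. *)
Definition rearrange n (src : {perm 'I_(2 * n)}) (turn : pred 'I_(2 * n))
    (c : config n) : config n :=
  ((src * c.1)%g, [ffun p => turn p (+) c.2 (src p)]).

Lemma rearrange_inj n (src : {perm 'I_(2 * n)}) (turn : pred 'I_(2 * n)) :
  injective (rearrange src turn).
Proof.
move=> [s o] [s' o'] [/mulgI -> /ffunP eo]; congr (_, _); apply/ffunP => p.
by have := eo ((src^-1)%g p); rewrite !ffunE permKV => /addbI.
Qed.

Definition out_flip n : {perm config n} :=
  perm (@rearrange_inj n (perm (@out_flip_src_inj n)) (fun p => odd p)).

Definition in_flip n : {perm config n} :=
  perm (@rearrange_inj n (perm (@in_flip_src_inj n)) (fun p => ~~ odd p)).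

(* [Flip n] is the flip group on [2 * n] cards. *)
Definition Flip n : {group {perm config n}} := <<[set out_flip n; in_flip n]>>%G.

(* The position of the card [k] together with its orientation. *)
Definition location n (c : config n) (k : 'I_(2 * n)) : 'I_(2 * n) * bool :=
  ((c.1^-1)%g k, c.2 ((c.1^-1)%g k)).

(* Permutation isomorphism: an isomorphism of groups compatible, through a
   bijection [theta], with the action of [Flip n] on the locations (position
   and orientation) of the cards of the first deck and the action of [Faro N] on
   the positions of the cards of the second. *)
Definition deck_isomorphic n N : Prop :=
  exists (f : {morphism Flip n >-> 'S_(2 * N)})
         (theta : 'I_(2 * n) * bool -> 'I_(2 * N)),
    [/\ isom (Flip n) (Faro N) f, bijective theta
      & forall g, g \in Flip n -> forall (c : config n) (k : 'I_(2 * n)),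
          theta (location (g c) k) = f g (theta (location c k))].

(* Main.v *)
Require Import Defs.
From mathcomp Require Import all_boot all_fingroup.
From mathcomp Require Import zify.

Set Implicit Arguments.
Unset Strict Implicit.
Unset Printing Implicit Defensive.

(* Spread a deck of [2 * n] two-sided cards into [4 * n] places by letting the
   two orientations at position [p] be the places [p] and [4 * n - 1 - p].  The
   faro shuffles of [4 * n] cards commute with the reversal
   [i |-> 4 * n - 1 - i], and on the orbits of this reversal they act as the
   flip shuffles do.  Since every location is attained and the locations of all
   the cards determine the configuration, a permutation of the configurations in
   [Flip n] and the permutation of the places it induces determine each other. *)

Section InducedIsomorphism.

Import GroupScope.

Variables (X Y K : finType) (loc : X -> K -> Y).
Hypothesis loc_surj : forall y, exists x k, loc x k = y.
Hypothesis loc_inj : forall x x', loc x =1 loc x' -> x = x'.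

Definition induces (g : {perm X}) (h : {perm Y}) : bool :=
  [forall x, forall k, loc (g x) k == h (loc x k)].

Lemma inducesP (g : {perm X}) (h : {perm Y}) :
  reflect (forall x k, loc (g x) k = h (loc x k)) (induces g h).
Proof.
apply: (iffP forallP) => [H x k|H x]; first by have /forallP/(_ k)/eqP := H x.
by apply/forallP => k; rewrite H.
Qed.

Lemma inducesM g g' h h' :
  induces g h -> induces g' h' -> induces (g * g') (h * h').
Proof.
move=> /inducesP H /inducesP H'.
by apply/inducesP => x k; rewrite !permM H' H.
Qed.

Lemma induces_uniq g h h' : induces g h -> induces g h' -> h = h'.
Proof.
move=> /inducesP H /inducesP H'; apply/permP => y.
by have [x [k <-]] := loc_surj y; rewrite -H H'.
Qed.

Lemma induces_inj g g' h : induces g h -> induces g' h -> g = g'.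
Proof.
move=> /inducesP H /inducesP H'; apply/permP => x.
by apply: loc_inj => k; rewrite H H'.
Qed.

Lemma induces1 : induces 1 1.
Proof. by apply/inducesP => x k; rewrite !perm1. Qed.

(** The default [1] is reached only when [g] induces nothing, which never occurs on the generated
    group below. *)
Definition induced (g : {perm X}) : {perm Y} :=
  odflt 1 [pick h | induces g h].

Lemma inducedE g h : induces g h -> induced g = h.
Proof.
rewrite /induced => gh; case: pickP => [h' gh'|/(_ h)]; last by rewrite gh.
exact: induces_uniq gh' gh.
Qed.

Lemma generated_isom (a b : {perm X}) (a' b' : {perm Y}) :
  induces a a' -> induces b b' ->
  exists f : {morphism <<[set a; b]>> >-> {perm Y}},
    isom <<[set a; b]>> <<[set a'; b']>> f
    /\ forall g, g \in <<[set a; b]>> -> induces g (f g).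
Proof.
move=> Ha Hb; set G := <<_>>.
(* Inducing something is stable under products, so it passes from the two generators to the whole
   group they generate. *)
have gS : group_set [set g | [exists h, induces g h]].
  apply/group_setP; split=> [|g g'].
    by rewrite inE; apply/existsP; exists 1; exact: induces1.
  rewrite !inE => /existsP[h gh] /existsP[h' gh'].
  by apply/existsP; exists (h * h'); exact: inducesM.
have indG g : g \in G -> induces g (induced g).
  have sG : G \subset Group gS.
    rewrite gen_subG; apply/subsetP => c /set2P[]->; rewrite inE.
      by apply/existsP; exists a'.
    by apply/existsP; exists b'.
  by move=> /(subsetP sG); rewrite inE => /existsP[h gh]; rewrite (inducedE gh).
have fM : {in G &, {morph induced : x y / x * y}}.
  by move=> g g' /indG gh /indG gh'; apply: inducedE; exact: inducesM.
exists (Morphism fM); split=> //; apply/isomP; split.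
  apply/injmP => g g' /indG gh /indG gh' /= e; apply: induces_inj gh _.
  by rewrite e.
have aG : a \in G by rewrite mem_gen // set21.
have bG : b \in G by rewrite mem_gen // set22.
rewrite morphim_gen ?subset_gen // morphimU !morphim_set1 //=.
by rewrite (inducedE Ha) (inducedE Hb).
Qed.

End InducedIsomorphism.

Definition place_nat n (p : nat) (b : bool) : nat :=
  if b then p else 4 * n - 1 - p.

Lemma place_subproof n (l : 'I_(2 * n) * bool) :
  place_nat n l.1 l.2 < 2 * (2 * n).
Proof. by have := ltn_ord l.1; rewrite /place_nat; case: ifP; lia. Qed.

Definition place n (l : 'I_(2 * n) * bool) : 'I_(2 * (2 * n)) :=
  Ordinal (place_subproof l).

(** Face-up locations fill the places below [2 * n] and face-down ones the rest, so no two
    collide. *)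
Lemma place_bij n : bijective (@place n).
Proof.
apply: inj_card_bij; last by rewrite card_prod card_bool !card_ord; lia.
move=> [p b] [q d] /(congr1 val) /=; rewrite /place_nat.
have := ltn_ord p; have := ltn_ord q.
by case: b; case: d => ? ? e; try lia; congr (_, _); apply: val_inj => /=; lia.
Qed.

Lemma location_surj n (l : 'I_(2 * n) * bool) :
  exists (c : config n) k, location c k = l.
Proof.
exists (1%g, [ffun=> l.2]), l.1.
by rewrite /location /= invg1 perm1 ffunE -surjective_pairing.
Qed.

Lemma location_inj n (c c' : config n) : location c =1 location c' -> c = c'.
Proof.
case: c c' => [s o] [s' o'] e.
have es : s = s'.
  by apply/invg_inj/permP => k; have [] := e k.
rewrite -{}es in e *; congr (_, _); apply/ffunP => p.
by have [] := e (s p); rewrite permK.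
Qed.

(** Here [src] goes from new positions to old ones and [h] from old places to new ones, so the
    condition to check is indexed by the new position [q]. *)
Lemma place_induces n (g : {perm config n}) (h : 'S_(2 * (2 * n)))
    (src : {perm 'I_(2 * n)}) (turn : pred 'I_(2 * n)) :
  g =1 rearrange src turn ->
  (forall q b, place (q, turn q (+) b) = h (place (src q, b))) ->
  induces (fun c k => place (location c k)) g h.
Proof.
move=> gE H; apply/inducesP => c k.
(* [H] is used at the new position of [k], the preimage under [src] of its old one. *)
rewrite gE /location /= invMg permM ffunE H.
by rewrite permKV.
Qed.

(** The faro cut at [2 * n] separates the face-up places from the face-down ones, so each branch of
    the faro formula handles one orientation [b] before the shuffle. *)
Lemma out_flip_induces n :
  induces (fun c k => place (location c k)) (out_flip n) (out_faro (2 * n)).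
Proof.
apply: place_induces => [c|q b]; first exact: permE.
rewrite !permE; apply: val_inj; rewrite /= /place_nat /out_faro_nat /out_flip_nat /=.
(* Writing [q] as twice its half plus its parity makes every case linear. *)
have := ltn_ord q; have := odd_double_half q.
by case: (odd q); case: b => /=; case: ifP; lia.
Qed.

Lemma in_flip_induces n :
  induces (fun c k => place (location c k)) (in_flip n) (in_faro (2 * n)).
Proof.
apply: place_induces => [c|q b]; first exact: permE.
rewrite !permE; apply: val_inj; rewrite /= /place_nat /in_faro_nat /in_flip_nat /=.
have := ltn_ord q; have := odd_double_half q.
by case: (odd q); case: b => /=; case: ifP; lia.
Qed.

Theorem theorem2 (n : nat) (hn : (0 < n)%N) :
  [/\ (Flip n \isog Faro (2 * n))%g,
      deck_isomorphic n (2 * n)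
    & #|Flip n| = #|Faro (2 * n)|].
Proof.
have surj y : exists (c : config n) k, place (location c k) = y.
  have [inv _ invK] := place_bij n; have [c [k e]] := location_surj (inv y).
  by exists c, k; rewrite e invK.
have inj (c c' : config n) :
    (fun k => place (location c k)) =1 (fun k => place (location c' k)) -> c = c'.
  by move=> e; apply: location_inj => k; exact: bij_inj (place_bij n) _ _ (e k).
have [f [isof fP]] :=
  generated_isom surj inj (out_flip_induces n) (in_flip_induces n).
have isoFF : (Flip n \isog Faro (2 * n))%g := isom_isog f (subxx _) isof.
split=> //; last exact: card_isog.
by exists f, (@place n); split=> [||g /fP/inducesP] //; exact: place_bij.
Qed.
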